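(* Let $G=(\mathbb{N}_0,w,m)$ be a normalized linear graph satisfying $\mathrm{CD}(0,D)$ for some $D<\infty$. Then $G$ satisfies the ellipticity property $E(\alpha)$ with $\alpha=1/D$, i.e. $w(x,y)\ge\frac1D\,m(x)$ whenever $x\sim y$.
   Context: A weighted graph $G=(V,E,w,m)$ is a connected, undirected, simple, locally finite graph $(V,E)$ with vertex weights $m:V\to(0,\infty)$ and symmetric edge weights $w:E\to(0,\infty)$, $w(x,y)=w(y,x)$ (with $w(x,y)=0$ if $x\not\sim y$). It is normalized if $m(x)=\sum_{y\sim x}w(x,y)$ for all $x\in V$. A linear graph on $\mathbb{N}_0=\{0,1,2,\dots\}$ has vertex set $V=\mathbb{N}_0$ and edge set $E=\{\{n,n+1\}: n\in\mathbb{N}_0\}$. The Laplacian is $\Delta f(x)=\frac1{m(x)}\sum_{y\sim x}w(x,y)(f(y)-f(x))$ for $f:V\to\mathbb{R}$. Set $\Gamma(f,g)=\frac12(\Delta(fg)-f\Delta g-g\Delta f)$, $\Gamma(f)=\Gamma(f,f)$, and $\Gamma_2(f)=\frac12\Delta\Gamma(f)-\Gamma(f,\Delta f)$. For $K\in\mathbb{R}$, $D\in(0,\infty]$ (with $1/\infty=0$) and $x\in V$, the condition $\mathrm{CD}(K,D,x)$ means $\Gamma_2(f)(x)\ge\frac1D(\Delta f(x))^2+K\,\Gamma(f)(x)$ for all $f:V\to\mathbb{R}$; $\mathrm{CD}(K,D)$ means that $\mathrm{CD}(K,D,x)$ holds for all $x\in V$. *)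

(* Defs.v *)
From mathcomp Require Import all_boot all_order all_algebra.
From mathcomp Require Import all_classical all_reals.

Set Implicit Arguments.
Unset Strict Implicit.
Unset Printing Implicit Defensive.

Import Order.TTheory GRing.Theory Num.Theory.
Local Open Scope ring_scope.

(* Local finiteness is encoded by giving each vertex the duplicate-free list
   of its neighbours; the order of that list plays no role. *)
Record wgraph (R : realType) (V : eqType) := WGraph {
  nbr : V -> seq V;
  wt : V -> V -> R;
  ms : V -> R;
  nbr_uniq : forall x, uniq (nbr x);
  nbr_irr : forall x, x \notin nbr x;
  nbr_sym : forall x y, (y \in nbr x) = (x \in nbr y);
  nbr_conn : forall x y,
    exists2 p, path (fun a b => b \in nbr a) x p & last x p = y;
  wt_sym : forall x y, wt x y = wt y x;
  wt_gt0 : forall x y, y \in nbr x -> 0 < wt x y;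
  wt_eq0 : forall x y, y \notin nbr x -> wt x y = 0;
  ms_gt0 : forall x, 0 < ms x
}.

Definition adj (R : realType) (V : eqType) (G : wgraph R V) : rel V :=
  fun x y => y \in nbr G x.

Definition normalized (R : realType) (V : eqType) (G : wgraph R V) : Prop :=
  forall x, ms G x = \sum_(y <- nbr G x) wt G x y.

Definition linear_graph (R : realType) (G : wgraph R nat) : Prop :=
  forall x y : nat, adj G x y = (y == x.+1) || (x == y.+1).

Definition lap (R : realType) (V : eqType) (G : wgraph R V)
    (f : V -> R) (x : V) : R :=
  (ms G x)^-1 * \sum_(y <- nbr G x) wt G x y * (f y - f x).

Definition Gam (R : realType) (V : eqType) (G : wgraph R V)
    (f g : V -> R) (x : V) : R :=
  2^-1 * (lap G (fun z => f z * g z) x - f x * lap G g x - g x * lap G f x).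

Definition Gam2 (R : realType) (V : eqType) (G : wgraph R V)
    (f : V -> R) (x : V) : R :=
  2^-1 * lap G (Gam G f f) x - Gam G f (lap G f) x.

(* The dimension D ranges over (0, +oo]; [fine D^-1] is the usual inverse for
   a nonzero real D and is 0 for D = +oo. *)
Definition CD_at (R : realType) (V : eqType) (G : wgraph R V)
    (K : R) (D : \bar R) (x : V) : Prop :=
  forall f : V -> R,
    fine (D^-1)%E * (lap G f x) ^+ 2 + K * Gam G f f x <= Gam2 G f x.

Definition CD (R : realType) (V : eqType) (G : wgraph R V)
    (K : R) (D : \bar R) : Prop :=
  forall x, CD_at G K D x.

Definition ellipticity (R : realType) (V : eqType) (G : wgraph R V)
    (alpha : R) : Prop :=
  forall x y, adj G x y -> alpha * ms G x <= wt G x y.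

(* Main.v *)
(* Write p n, q n for the probabilities of stepping from n to n + 1 and to
   n - 1.  Testing CD(0, D) at n on f k = max (k - n) 0 and at n + 1 on
   f k = max (n + 1 - k) 0 yields
     2 / D * p n <= p n + q (n + 1) - p (n + 1)   and
     2 / D * q (n + 1) <= q (n + 1) + p n - q n.
   For D < 2 these two inequalities force both p 1 < q 1 and q 1 < p 1, so
   2 <= D, and then p <= 1 and q <= 1 turn them into 1 / D <= q (n + 1) and
   1 / D <= p n. *)
Require Import Defs.
From mathcomp Require Import all_boot all_order all_algebra.
From mathcomp Require Import all_classical all_reals.
From mathcomp Require Import ring lra zify.

Import Order.TTheory GRing.Theory Num.Theory.
Local Open Scope ring_scope.

Section LinearGraph.
Variables (R : realType) (G : wgraph R nat).
Hypotheses (hlin : linear_graph G) (hnorm : normalized G).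

Definition step_up (n : nat) : R := wt G n n.+1 / ms G n.

(* At n = 0 this is wt G 0 0 / ms G 0 = 0, as 0.-1 = 0 and there are no loops. *)
Definition step_down (n : nat) : R := wt G n n.-1 / ms G n.

Local Notation p := step_up.
Local Notation q := step_down.

Lemma linear_nbrS n : n.+1 \in nbr G n.
Proof. by have := hlin n n.+1; rewrite /adj eqxx. Qed.

Lemma step_up_gt0 n : 0 < p n.
Proof. by rewrite divr_gt0 ?ms_gt0 // wt_gt0 // linear_nbrS. Qed.

Lemma step_downS_gt0 n : 0 < q n.+1.
Proof. by rewrite divr_gt0 ?ms_gt0 //= wt_sym wt_gt0 // linear_nbrS. Qed.

Lemma step_down0 : q 0 = 0.
Proof. by rewrite /q wt_eq0 ?mul0r // nbr_irr. Qed.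

Lemma step_down_ge0 n : 0 <= q n.
Proof. by case: n => [|n]; rewrite ?step_down0 // ltW // step_downS_gt0. Qed.

(** The formula also covers [n = 0]: there [0.-1 = 0], and the vanishing loop weight [wt G 0 0]
    kills the second term. *)
Lemma sum_nbr_linear (F : nat -> R) n :
  \sum_(y <- nbr G n) wt G n y * F y =
  wt G n n.+1 * F n.+1 + wt G n n.-1 * F n.-1.
Proof.
case: n => [|n] /=.
- rewrite (perm_big [:: 1%N]) /=; last first.
    apply: uniq_perm; rewrite ?nbr_uniq // => y.
    by have := hlin 0%N y; rewrite /adj inE => ->; lia.
  by rewrite big_seq1 [wt G 0 0]wt_eq0 ?nbr_irr // mul0r addr0.
- rewrite (perm_big [:: n.+2; n]) /=; last first.
    apply: uniq_perm; rewrite ?nbr_uniq //=; first by rewrite inE; lia.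
    by move=> y; have := hlin n.+1 y; rewrite /adj !inE => ->; lia.
  by rewrite big_cons big_seq1.
Qed.

Lemma step_sum n : p n + q n = 1.
Proof.
rewrite -mulrDl -[X in X / _](_ : ms G n = _) ?divff ?gt_eqF ?ms_gt0 //.
rewrite hnorm; have := sum_nbr_linear (fun=> 1) n; rewrite !mulr1 => <-.
by apply: eq_bigr => y _; rewrite mulr1.
Qed.

Lemma lap_linear (f : nat -> R) n :
  lap G f n = p n * (f n.+1 - f n) + q n * (f n.-1 - f n).
Proof. by rewrite /lap (sum_nbr_linear (fun y => f y - f n)) /p /q; ring. Qed.

Lemma Gam_linear (f g : nat -> R) n :
  Gam G f g n = 2^-1 * (p n * ((f n.+1 - f n) * (g n.+1 - g n)) +
                        q n * ((f n.-1 - f n) * (g n.-1 - g n))).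
Proof. by rewrite /Gam !lap_linear; ring. Qed.

Section Curvature.
Variables (D : R) (hD : 0 < D) (hCD : CD G 0 D%:E).

Lemma curvature_up n : 2 / D * p n <= p n + q n.+1 - p n.+1.
Proof.
have p_gt0 := step_up_gt0 n; have sum_n := step_sum n.
(* For this truncated ramp the Laplacian at [n] is [p n] and [Gam2] is [p n / 2] times the
   right-hand side, so [p n] is the factor to cancel. *)
rewrite -(ler_pM2l p_gt0); have := hCD n (fun k => (k - n)%:R).
rewrite fine_invr mul0r addr0 /Gam2 !(lap_linear, Gam_linear).
have -> : q n = 1 - p n by rewrite -sum_n; ring.
have -> : q n.+1 = 1 - p n.+1 by rewrite -(step_sum n.+1); ring.
(* At [0] no left neighbour cancels the term [p n * (1 - p n) / 4] of [Gam2]; it vanishes because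
   [p 0 = 1]. *)
case: n p_gt0 sum_n => [|n] p_gt0 sum_n /=.
  have -> : p 0 = 1 by rewrite -sum_n step_down0 addr0.
  by rewrite ?subnn ?subn0; lra.
have -> : (n.+1 - n.+1 = 0)%N by lia.
have -> : (n.+2 - n.+1 = 1)%N by lia.
have -> : (n.+3 - n.+1 = 2)%N by lia.
have -> : (n - n.+1 = 0)%N by lia.
have -> : (n.-1 - n.+1 = 0)%N by lia.
by lra.
Qed.

Lemma curvature_down n : 2 / D * q n.+1 <= q n.+1 + p n - q n.
Proof.
have q_gt0 := step_downS_gt0 n.
rewrite -(ler_pM2l q_gt0); have := hCD n.+1 (fun k => (n.+1 - k)%:R).
rewrite fine_invr mul0r addr0 /Gam2 !(lap_linear, Gam_linear).
have -> : p n.+1 = 1 - q n.+1 by rewrite -(step_sum n.+1); ring.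
rewrite /=.
have -> : (n.+1 - n.+1 = 0)%N by lia.
have -> : (n.+1 - n = 1)%N by lia.
have -> : (n.+1 - n.+2 = 0)%N by lia.
have -> : (n.+1 - n.+3 = 0)%N by lia.
(* At [n = 0] the ramp takes the value [1] instead of [2] at [n.-1], which is harmless since
   [q 0 = 0]. *)
case: n {q_gt0} => [|n] /=.
  rewrite step_down0.
  have -> : p 0 = 1 by rewrite -(step_sum 0) step_down0 addr0.
  by lra.
have -> : p n.+1 = 1 - q n.+1 by rewrite -(step_sum n.+1); ring.
have -> : (n.+2 - n = 2)%N by lia.
by lra.
Qed.

Lemma two_le_dim : 2 <= D.
Proof.
rewrite leNgt; apply/negP => D_lt2.
have inv_gt : 1 < 2 / D by rewrite ltr_pdivlMr // mul1r.
have up n : p n < 2 / D * p n by rewrite ltr_pMl // step_up_gt0.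
have down n : q n.+1 < 2 / D * q n.+1 by rewrite ltr_pMl // step_downS_gt0.
(* The upward bound at [0] gives [p 1 < q 1], the downward one with index [1] gives [q 1 < p 1]. *)
have := up 0; have := down 1%N; have := curvature_up 0.
have := curvature_down 1%N; lra.
Qed.

(** Since [q n = 1 - p n], the downward inequality reads [1 - (1 - 2 / D) * q n.+1 <= 2 * p n]; its
    left side is smallest at [q n.+1 = 1]. *)
Lemma inv_dim_le_step_up n : D^-1 <= p n.
Proof.
have inv_le : 2 / D <= 1 by rewrite ler_pdivrMr // mul1r two_le_dim.
have q_le1 : q n.+1 <= 1.
  by rewrite -(step_sum n.+1) lerDr ltW // step_up_gt0.
have := curvature_down n; have := step_sum n.
have : 0 <= (1 - 2 / D) * (1 - q n.+1) by rewrite mulr_ge0 ?subr_ge0.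
lra.
Qed.

Lemma inv_dim_le_step_down n : D^-1 <= q n.+1.
Proof.
have inv_le : 2 / D <= 1 by rewrite ler_pdivrMr // mul1r two_le_dim.
have p_le1 : p n <= 1 by rewrite -(step_sum n) lerDl step_down_ge0.
have := curvature_up n; have := step_sum n.+1.
(* The nonlinear ingredient: it says that [2 / D <= 1 - (1 - 2 / D) * p n]. *)
have : 0 <= (1 - 2 / D) * (1 - p n) by rewrite mulr_ge0 ?subr_ge0.
lra.
Qed.

End Curvature.
End LinearGraph.

Theorem corollary1p14 (R : realType) (G : wgraph R nat)
    (hlin : linear_graph G) (hnorm : normalized G)
    (D : R) (hD : 0 < D) (hCD : CD G 0 D%:E) :
  ellipticity G (1 / D).
Proof.
move=> x y; rewrite hlin div1r -ler_pdivlMr ?ms_gt0 // => /orP[] /eqP ->.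
  exact: inv_dim_le_step_up.
exact: inv_dim_le_step_down.
Qed.
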